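(* Let $\Phi$ be a graphing on a standard probability space $(X,\mu)$. Then the metric $\tilde d_\Phi$ on the $\mathrm L^1$ full group $[\Phi]_1$ is complete and separable.
   Context: A standard probability space $(X,\mu)$ is a standard Borel space with a non-atomic Borel probability measure; everything is up to null sets. $\mathrm{Aut}(X,\mu)$ is the group of measure-preserving Borel bijections of $X$ modulo a.e. equality. A partial isomorphism is a measure-preserving Borel bijection $\varphi:\mathrm{dom}\,\varphi\to\mathrm{rng}\,\varphi$ between Borel subsets of $X$. A graphing $\Phi$ is a countable set of partial isomorphisms; it generates the equivalence relation $\mathcal R_\Phi$, the smallest one containing all $(x,\varphi(x))$ with $\varphi\in\Phi$, $x\in\mathrm{dom}\,\varphi$. On $\mathcal R_\Phi$-classes put $d_\Phi(x,y)=\min\{n\in\mathbb N:\exists\varphi_1,\dots,\varphi_n\in\Phi\cup\Phi^{-1},\ y=\varphi_n\cdots\varphi_1(x)\}$. The full group is $[\mathcal R_\Phi]=\{T\in\mathrm{Aut}(X,\mu):(x,T(x))\in\mathcal R_\Phi\text{ a.e.}\}$, the $\mathrm L^1$ full group is $[\Phi]_1=\{T\in[\mathcal R_\Phi]:\int_Xd_\Phi(x,T(x))\,d\mu(x)<+\infty\}$, and $\tilde d_\Phi(S,T)=\int_Xd_\Phi(S(x),T(x))\,d\mu(x)$ for $S,T\in[\Phi]_1$. *)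

(* Defs.v *)
From HB Require Import structures.
From mathcomp Require Import all_boot all_order all_algebra.
From mathcomp Require Import all_classical all_reals all_analysis.
From mathcomp Require Import measurable_realfun.

Set Implicit Arguments.
Unset Strict Implicit.
Unset Printing Implicit Defensive.

Import Order.TTheory GRing.Theory Num.Theory.
Import numFieldNormedType.Exports.

Local Open Scope classical_set_scope.
Local Open Scope ring_scope.
Local Open Scope ereal_scope.

Definition complete_space (Y : uniformType) : Prop :=
  forall F : set_system Y, ProperFilter F -> cauchy F ->
    exists y : Y, F --> y.

Definition separable_space (Y : topologicalType) : Prop :=
  exists2 D : set Y, countable D & dense D.

(* [f] is a bijection of [X] onto the Polish space [Y] which identifies the
   measurable sets of [X] with the Borel sets of [Y]. *)
Definition standard_borel (R : realType) d (X : measurableType d) : Prop :=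
  exists (Y : metricType R) (f : X -> Y),
    [/\ complete_space Y, separable_space Y, bijective f &
        forall B : set Y, <<s open >> B <-> measurable (f @^-1` B)].

Definition nonatomic (R : realType) d (X : measurableType d)
    (mu : {measure set X -> \bar R}) : Prop :=
  forall A : set X, measurable A -> 0 < mu A ->
    exists B : set X, [/\ measurable B, B `<=` A, 0 < mu B & mu B < mu A].

Record standard_probability d (X : measurableType d) (R : realType) :=
  StandardProbability {
    sp_prob :> probability X R ;
    sp_standard : standard_borel R X ;
    sp_nonatomic : nonatomic sp_prob }.

(* "Borel bijection" is taken in the sense of an isomorphism of measurable
   spaces: the inverse map is measurable as well, i.e. images of measurable
   subsets of [A] are measurable. The values of [f] outside [A] are junk. *)
Record measure_iso (R : realType) d (X : measurableType d)
    (mu : {measure set X -> \bar R}) (A B : set X) (f : X -> X) : Prop :=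
  MeasureIso {
    iso_dom : measurable A ;
    iso_rng : measurable B ;
    iso_bij : set_bij A B f ;
    iso_measurable : measurable_fun A f ;
    iso_image : forall C, measurable C -> C `<=` A -> measurable (f @` C) ;
    iso_mu : forall C, measurable C -> C `<=` A -> mu (f @` C) = mu C }.

Record partial_iso (R : realType) d (X : measurableType d)
    (mu : {measure set X -> \bar R}) := PartialIso {
  pdom : set X ;
  prng : set X ;
  pfun :> X -> X ;
  pfunP : measure_iso mu pdom prng pfun }.

Record graphing (R : realType) d (X : measurableType d)
    (mu : {measure set X -> \bar R}) := Graphing {
  gset :> set (partial_iso mu) ;
  gset_countable : countable gset }.

Section graphing_distance.
Context (R : realType) d (X : measurableType d).
Context (mu : {measure set X -> \bar R}) (Phi : graphing mu).

Definition graphing_rel : set (X * X) :=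
  smallest [set E | RelationClasses.Equivalence (fun x y => E (x, y))]
           [set xy | exists2 phi, gset Phi phi & pdom phi xy.1 /\ xy.2 = phi xy.1].

(* [y = phi x] or [y = phi^-1 x] for some [phi] in [Phi] *)
Definition graphing_step (x y : X) : Prop :=
  exists2 phi, gset Phi phi &
    (pdom phi x /\ y = phi x) \/ (pdom phi y /\ x = phi y).

Fixpoint graphing_walk (n : nat) (x y : X) : Prop :=
  if n is n'.+1 then exists2 z, graphing_walk n' x z & graphing_step z y
  else x = y.

(* This is the minimal length of a walk from [x] to [y]; it is [+oo] when
   there is none, that is when [x] and [y] are not equivalent. *)
Definition graphing_dist (x y : X) : \bar R :=
  ereal_inf [set n%:R%:E | n in [set n | graphing_walk n x y]].

End graphing_distance.

Section automorphisms.
Context (R : realType) d (X : measurableType d).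
Context (mu : {measure set X -> \bar R}).

Record mpbij := Mpbij {
  mpbij_fun :> X -> X ;
  mpbijP : measure_iso mu setT setT mpbij_fun }.

HB.instance Definition _ := gen_eqMixin mpbij.
HB.instance Definition _ := gen_choiceMixin mpbij.

Definition mpbij_ae_eq (S T : mpbij) := `[< S = T %[ae mu] >].

Let mpbij_ae_eq_refl : reflexive mpbij_ae_eq.
Proof. by move=> S; exact/asboolP/aeW. Qed.

Let mpbij_ae_eq_sym : symmetric mpbij_ae_eq.
Proof.
by move=> S T; apply/idP/idP => /asboolP h; apply/asboolP/ae_eq_sym.
Qed.

Let mpbij_ae_eq_trans : transitive mpbij_ae_eq.
Proof.
by move=> T S U /asboolP ST /asboolP TU; apply/asboolP/(ae_eq_trans ST TU).
Qed.

Canonical mpbij_ae_eq_canonical :=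
  EquivRel mpbij_ae_eq mpbij_ae_eq_refl mpbij_ae_eq_sym mpbij_ae_eq_trans.

Local Open Scope quotient_scope.

Definition Aut : Type := {eq_quot mpbij_ae_eq}.
HB.instance Definition _ := Choice.on Aut.
HB.instance Definition _ := EqQuotient.on Aut.

(* The quantities defined below from an element of [Aut] through its
   representative only depend on the values of the latter almost everywhere. *)
Definition Aut_fun (S : Aut) : X -> X := repr S.
Coercion Aut_fun : Aut >-> Funclass.

Lemma Aut_eqP (S T : Aut) : S = T <-> S = T %[ae mu].
Proof.
rewrite -[S in S = T]reprK -[T in _ = T]reprK; split=> [/eqmodP/asboolP//|h].
exact/eqmodP/asboolP.
Qed.

End automorphisms.

Section L1_full_group.
Context (R : realType) d (X : measurableType d).
Context (mu : {measure set X -> \bar R}) (Phi : graphing mu).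

Definition full_group : set (Aut mu) :=
  [set T | {ae mu, forall x, graphing_rel Phi (x, T x)}].

Definition L1_full_set : set (Aut mu) :=
  full_group `&` [set T | \int[mu]_x graphing_dist Phi x (T x) < +oo].

Definition L1_full_group : Type := {T : Aut mu | T \in L1_full_set}.
HB.instance Definition _ := Choice.on L1_full_group.

Definition L1_full_val (T : L1_full_group) : Aut mu := val T.
Coercion L1_full_val : L1_full_group >-> Aut.

Definition L1_dist (S T : L1_full_group) : \bar R :=
  \int[mu]_x graphing_dist Phi (S x) (T x).

End L1_full_group.

Section walks.
Context (R : realType) d (X : measurableType d).
Context (mu : {measure set X -> \bar R}) (Phi : graphing mu).
Local Notation walk := (graphing_walk Phi).
Local Notation dist := (graphing_dist Phi).

Lemma graphing_step_sym x y : graphing_step Phi x y -> graphing_step Phi y x.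
Proof. by move=> [phi Pphi h]; exists phi => //; case: h; [right|left]. Qed.

Lemma graphing_walk_cat m n x y z :
  walk m x y -> walk n y z -> walk (m + n) x z.
Proof.
move=> xy; elim: n z => [|n IHn] z /=; first by rewrite addn0 => <-.
by move=> [t yt tz]; rewrite addnS; exists t => //; exact: IHn.
Qed.

Lemma graphing_walk_sym n x y : walk n x y -> walk n y x.
Proof.
elim: n y => [//|n IHn] y [z xz zy].
rewrite -add1n; apply: (@graphing_walk_cat _ _ _ z); last exact: IHn.
by exists y => //; exact: graphing_step_sym.
Qed.

Lemma graphing_dist_le n x y : walk n x y -> dist x y <= n%:R%:E.
Proof. by move=> xy; apply: ereal_inf_lbound; exists n. Qed.

Lemma graphing_dist_ge0 x y : 0 <= dist x y.
Proof. by apply: le_ereal_inf_tmp => _ [n _ <-]; rewrite lee_fin. Qed.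

Lemma graphing_dist_lt (e : \bar R) x y : dist x y < e ->
  exists2 n, walk n x y & n%:R%:E < e.
Proof. by move=> /ereal_inf_lt[_ [n xy <-] ne]; exists n. Qed.

Lemma graphing_distxx x : dist x x = 0.
Proof.
apply/eqP; rewrite eq_le graphing_dist_ge0 andbT.
exact: (@graphing_dist_le 0).
Qed.

Lemma graphing_dist_eq0 x y : dist x y = 0 -> x = y.
Proof.
move=> xy0; have /graphing_dist_lt[[|n] //] : dist x y < 1 by rewrite xy0.
by move=> _; rewrite lte_fin ltrn1.
Qed.

Lemma graphing_dist_sym x y : dist x y = dist y x.
Proof.
by rewrite /graphing_dist; congr ereal_inf; apply/seteqP; split=> _ [n xy <-];
  exists n => //; exact: graphing_walk_sym.
Qed.

Lemma graphing_dist_triangle y x z : dist x z <= dist x y + dist y z.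
Proof.
have [->|xyoo] := eqVneq (dist x y) +oo.
  by rewrite addye ?leey// gt_eqF// (lt_le_trans _ (graphing_dist_ge0 y z)).
have [->|yzoo] := eqVneq (dist y z) +oo.
  by rewrite addey ?leey// gt_eqF// (lt_le_trans _ (graphing_dist_ge0 x y)).
suff min u v : dist u v != +oo -> exists2 n, walk n u v & dist u v = n%:R%:E.
  have [m xy ->] := min _ _ xyoo; have [n yz ->] := min _ _ yzoo.
  by rewrite -EFinD -natrD; apply/graphing_dist_le/graphing_walk_cat/yz.
rewrite -ltey => /graphing_dist_lt[n0 w0 _].
have /ex_minnP[n /asboolP uv nmin] : exists n, `[< walk n u v >].
  by exists n0; exact/asboolP.
exists n => //; apply/eqP; rewrite eq_le graphing_dist_le//=.
apply: le_ereal_inf_tmp => _ [k uvk <-].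
by rewrite lee_fin ler_nat nmin//; exact/asboolP.
Qed.

End walks.

Section measurability.
Context (R : realType) d (X : measurableType d).

Lemma countable_bigcup_measurable (I : Type) (Q : set I) (F : I -> set X) :
  countable Q -> (forall i, Q i -> measurable (F i)) ->
  measurable (\bigcup_(i in Q) F i).
Proof.
move=> /pfcard_geP[->|[e]] mF; first by rewrite bigcup_set0.
have -> : \bigcup_(i in Q) F i = \bigcup_n F (e n).
  apply/seteqP; split=> x [i Qi Fx]; last by exists (e i) => //; exact: funS.
  by have [n _ en] := 'surj_e Qi; exists n => //; rewrite en.
by apply: bigcup_measurable => n _; apply: mF; exact: funS.
Qed.

Lemma standard_borel_eq (D : set X) (f g : X -> X) : standard_borel R X ->
  measurable D -> measurable_fun D f -> measurable_fun D g ->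
  measurable (D `&` [set x | f x = g x]).
Proof.
move=> [Y [h [_ [Q Qct Qdense] [h' hK _] hB]]] mD mf mg.
pose U (q : Y) (n : nat) : set X := h @^-1` ball q n.+1%:R^-1.
have oball (q : Y) (e : R) : open (ball q e).
  rewrite openE => y; rewrite ballEmdist/= -subr_gt0 => qy.
  apply/nbhs_ballP; exists (e - mdist q y)%R => //= z.
  rewrite !ballEmdist/= ltrBrDl; exact: le_lt_trans (metric_triangle _ _ _).
have mU q n : measurable (U q n) by apply: (proj1 (hB _)); apply: sub_sigma_algebra; exact: oball.
have -> : D `&` [set x | f x = g x] = D `\` \bigcup_(q in Q) \bigcup_n
    ((D `&` f @^-1` U q n) `\` (D `&` g @^-1` U q n)).
  apply/seteqP; split=> x [Dx /= fg]; split=> //.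
    by move=> [q _ [n _ [[_ /= fU] gU]]]; apply: gU; split=> //=; rewrite -fg.
  apply/(can_inj hK)/eqP; apply/negPn/negP; rewrite -mdist_gt0 => fg0.
  apply: fg.
  have /ltr_add_invr[n] : (0 < mdist (h (f x)) (h (g x)) / 2)%R.
    by rewrite divr_gt0.
  rewrite add0r => nfg.
  have [||q [fq Qq]] := Qdense (ball (h (f x)) n.+1%:R^-1) => //.
    by exists (h (f x)); rewrite ballEmdist/= mdistxx.
  exists q => //; exists n => //; split; first by split=> //; exact: ball_sym.
  move=> [_ /= gq]; have := ball_triangle fq gq.
  rewrite ballEmdist/=; apply/negP; rewrite -leNgt ltW//.
  by rewrite [ltRHS](splitr (mdist _ _)) ltrD.
apply: measurableD => //; apply: countable_bigcup_measurable => // q _.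
by apply: bigcup_measurable => n _; apply: measurableD; [exact: mf|exact: mg].
Qed.

Context (mu : {measure set X -> \bar R}).

Lemma measure_iso_pinv (A B : set X) (f : X -> X) : measure_iso mu A B f ->
  measurable_fun B ('pinv_(fun=> point) A f).
Proof.
move=> [mA mB fAB mf imf _] _ C mC.
have -> : B `&` 'pinv_(fun=> point) A f @^-1` C = f @` (A `&` C).
  have [ffun finj fsurj] := fAB; apply/seteqP; split=> y.
    move=> [By Cy]; have [x Ax xy] := fsurj _ By.
    exists x => //; split => //; move: Cy.
    by rewrite /= -xy pinvKV ?inE.
  move=> [x [Ax Cx] <-]; split; first exact: ffun.
  by rewrite /= pinvKV ?inE.
by apply: imf => //; exact: measurableI.
Qed.

Context (Phi : graphing mu) (stdX : standard_borel R X).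

Lemma graphing_walk_measurable n (D : set X) (f g : X -> X) :
  measurable D -> measurable_fun D f -> measurable_fun D g ->
  measurable (D `&` [set x | graphing_walk Phi n (f x) (g x)]).
Proof.
elim: n D g => [|n IHn] D g mD mf mg; first exact: standard_borel_eq.
pose F (A : set X) (k : X -> X) : set X := (D `&` g @^-1` A) `&`
  [set x | graphing_walk Phi n (f x) ((k \o g) x)].
have mF A k : measurable A -> measurable_fun A k -> measurable (F A k).
  move=> mA mk; have mDA : measurable (D `&` g @^-1` A) by exact: mg.
  apply: IHn => //; first by apply: measurable_funS mf => //; exact: subIsetl.
  apply: (measurable_comp mA) => //; first by move=> _ [x [_ Ax] <-].
  by apply: measurable_funS mg => //; exact: subIsetl.
pose inv (phi : partial_iso mu) := 'pinv_(fun=> point) (pdom phi) phi.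
have -> : D `&` [set x | graphing_walk Phi n.+1 (f x) (g x)] =
    \bigcup_(phi in gset Phi)
      (F (pdom phi) phi `|` F (prng phi) (inv phi)).
  apply/seteqP; split=> x.
    move=> [Dx /= [z fz [phi Pphi [[phiz gz]|[phig zg]]]]]; exists phi => //.
      have [ffun finj _] := iso_bij (pfunP phi).
      right; split; first by split=> //=; rewrite gz; exact: ffun.
      by rewrite /= gz /inv pinvKV ?inE.
    by left; split=> //=; rewrite -zg.
  move=> [phi Pphi [|] [[Dx /= gx] w]]; split=> //=.
    by exists (phi (g x)) => //; exists phi => //; right.
  have [_ finj fsurj] := iso_bij (pfunP phi).
  have [z zd zg] := fsurj _ gx.
  exists (inv phi (g x)) => //; exists phi => //; left.
  by rewrite -zg /inv pinvKV ?inE.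
apply: countable_bigcup_measurable; first exact: gset_countable.
move=> phi _; apply: measurableU; apply: mF.
- exact: iso_dom (pfunP phi).
- exact: iso_measurable (pfunP phi).
- exact: iso_rng (pfunP phi).
- exact: measure_iso_pinv (pfunP phi).
Qed.

Lemma graphing_dist_measurable (f g : X -> X) :
  measurable_fun setT f -> measurable_fun setT g ->
  measurable_fun setT (fun x => graphing_dist Phi (f x) (g x)).
Proof.
move=> mf mg.
apply: (measurability _ (ErealGenInftyO.measurableE R)) => _ /= -[_ [r ->] <-].
rewrite setTI; have -> : (fun x => graphing_dist Phi (f x) (g x)) @^-1`
    [set` `]-oo, r%:E[%O] = \bigcup_(n in [set n | (n%:R < r)%R])
    [set x | graphing_walk Phi n (f x) (g x)].
  apply/seteqP; split=> x /=; rewrite in_itv/=.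
    by move=> /graphing_dist_lt[n w]; rewrite lte_fin => nr; exists n.
  move=> [n /= nr w]; apply: le_lt_trans (graphing_dist_le w) _.
  by rewrite lte_fin.
apply: bigcup_measurable => n _.
by rewrite -[X in measurable X]setTI; exact: graphing_walk_measurable.
Qed.

End measurability.

Section L1_metric.
Context (R : realType) d (X : measurableType d).
Context (mu : standard_probability X R) (Phi : graphing mu).
Implicit Types S T U : L1_full_group Phi.

Let measurable_dist (f g : X -> X) :
  measurable_fun setT f -> measurable_fun setT g ->
  measurable_fun setT (fun x => graphing_dist Phi (f x) (g x)).
Proof. exact/graphing_dist_measurable/sp_standard. Qed.

Let measurable_L1 T : measurable_fun setT T.
Proof. exact: iso_measurable (mpbijP (repr (T : Aut mu))). Qed.

Let integral_triangle (f g h : X -> X) :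
  measurable_fun setT f -> measurable_fun setT g -> measurable_fun setT h ->
  \int[mu]_x graphing_dist Phi (f x) (h x) <=
  \int[mu]_x graphing_dist Phi (f x) (g x) +
  \int[mu]_x graphing_dist Phi (g x) (h x).
Proof.
move=> mf mg mh.
rewrite -ge0_integralD//; [|by move=> *; exact: graphing_dist_ge0|
  exact: measurable_dist|by move=> *; exact: graphing_dist_ge0|
  exact: measurable_dist].
apply: ge0_le_integral => //; [by move=> *; exact: graphing_dist_ge0|
  exact: measurable_dist| |by move=> *; exact: graphing_dist_triangle].
by apply: emeasurable_funD; exact: measurable_dist.
Qed.

Lemma L1_dist_sym S T : L1_dist S T = L1_dist T S.
Proof. by apply: eq_integral => x _; exact: graphing_dist_sym. Qed.

Lemma L1_dist_triangle T S U : L1_dist S U <= L1_dist S T + L1_dist T U.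
Proof. exact: integral_triangle. Qed.

Lemma L1_dist_fin_num S T : L1_dist S T \is a fin_num.
Proof.
rewrite ge0_fin_numE; last first.
  by apply: integral_ge0 => x _; exact: graphing_dist_ge0.
apply: le_lt_trans (integral_triangle (g := id) _ _ _) _ => //.
have /set_mem[_ /= T1] := valP T; have /set_mem[_ /= S1] := valP S.
rewrite lte_add_pinfty//; apply: le_lt_trans S1.
by under eq_integral do rewrite graphing_dist_sym.
Qed.

Lemma L1_dist_eq0 S T : L1_dist S T = 0 -> S = T.
Proof.
move=> ST0; apply/val_inj/Aut_eqP.
have mST := measurable_dist (measurable_L1 S) (measurable_L1 T).
have [+ _] := ae_eq_integral_abs mu measurableT mST.
rewrite (_ : \int[mu]_x _ = 0); last first.
  rewrite -ST0; apply: eq_integral => x _.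
  by rewrite gee0_abs//; exact: graphing_dist_ge0.
move=> /(_ erefl) ST; near=> x => _.
apply: (@graphing_dist_eq0 _ _ _ _ Phi); near: x.
by apply: filterS ST => x /= h; exact: h.
Unshelve. all: by end_near.
Qed.

Let L1_mdist S T : R := fine (L1_dist S T).

Let L1_mdistxx S : L1_mdist S S = 0%R.
Proof.
by rewrite /L1_mdist /L1_dist integral0_eq// => x _; exact: graphing_distxx.
Qed.

Let L1_mdist_positivity S T : L1_mdist S T = 0%R -> S = T.
Proof.
move=> ST0; apply: L1_dist_eq0.
by rewrite -[LHS]fineK ?L1_dist_fin_num//; rewrite -/(L1_mdist S T) ST0.
Qed.

Let L1_mdist_sym S T : L1_mdist S T = L1_mdist T S.
Proof. by rewrite /L1_mdist L1_dist_sym. Qed.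

Let L1_mdist_triangle T S U : (L1_mdist S U <= L1_mdist S T + L1_mdist T U)%R.
Proof.
by rewrite -lee_fin EFinD !fineK ?L1_dist_fin_num//; exact: L1_dist_triangle.
Qed.

(* See [L1_mdistE] for the distance. *)
HB.instance Definition _ := isMetric.Build R (L1_full_group Phi)
  L1_mdistxx L1_mdist_positivity L1_mdist_sym L1_mdist_triangle.

Lemma L1_mdistE S T : (mdist S T)%:E = L1_dist S T.
Proof. exact/fineK/L1_dist_fin_num. Qed.

End L1_metric.

(* Main.v *)
Require Import Defs.
From mathcomp Require Import all_boot all_order all_algebra.
From mathcomp Require Import all_classical all_reals all_analysis.
From mathcomp Require Import measurable_realfun.
From mathcomp Require Import lra.

Set Implicit Arguments.
Unset Strict Implicit.
Unset Printing Implicit Defensive.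

Import Order.TTheory GRing.Theory Num.Theory.
Import numFieldNormedType.Exports.

Local Open Scope classical_set_scope.
Local Open Scope ring_scope.
Local Open Scope ereal_scope.

(** The two halves of the theorem are independent.

    Completeness.  It suffices to find a limit for a sequence [T n] whose
    successive distances are at most [2 ^- n.+1].  The integral of the series
    of the [dist (T n x) (T n.+1 x)] is then finite, so that almost every
    series converges; since the graph distance takes its values in the
    natural numbers and [+oo], almost every sequence [T n x] is eventually
    constant.  Let [f] be the pointwise limit.  It coincides with [T n] on a
    measurable set [A n], and the [A n] increase to a conull set, so [f] is
    injective there and preserves the measure of images.  Hence its range is
    conull as well, although the distance says nothing about the inverses of
    the [T n].  A map of this kind becomes a bijection of the whole space once
    it is replaced by the identity off a conull invariant set ([exists_glued_mpbij]), and the tails of the series bound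
    the distance from [T n] to the limit ([fast_Cauchy_cvg]).

    Separability.  The L1 full group sits in the larger space of measurable
    maps [X -> X] at finite integrated distance from the identity, and it is
    enough to find countably many maps there which approximate all of its
    elements ([countable_step_maps]).  Extending the elements of the graphing
    and their inverses by the identity, and composing, gives countably many
    total measurable maps, the words, each at bounded distance from the
    identity, and such that [T x] is almost surely the image of [x] by some
    word.  Thus [T] is the limit, by dominated convergence, of maps which
    follow finitely many words on finitely many measurable pieces and are the
    identity elsewhere.  The measure algebra being separable
    ([countable_approximating_family]), the pieces may be replaced by elements
    of a countable family of sets; the boundedness of words makes the
    resulting error small ([piecewise_approx]). *)

(** * Gluing measure-preserving bijections *)

Section gluing.
Context (R : realType) d (X : measurableType d)
  (mu : {measure set X -> \bar R}).
Context (T : nat -> X -> X) (A : nat -> set X) (f : X -> X).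
Context (mu_fin : mu setT < +oo).
Context (isoT : forall n, measure_iso mu setT setT (T n)).
Context (mA : forall n, measurable (A n)).
Context (ndA : {homo A : m n / (m <= n)%N >-> m `<=` n}).
Context (fT : forall n x, A n x -> f x = T n x).
Context (A_conull : mu (~` \bigcup_n A n) = 0).

Let D : set X := \bigcup_n A n.
Let B : set X := f @` D.

Let mD : measurable D. Proof. exact: bigcup_measurable. Qed.

Let glued_image_bigcup C : f @` (D `&` C) = \bigcup_n T n @` (A n `&` C).
Proof.
apply/seteqP; split=> [_ [x [[n _ Anx] Cx] <-]|_ [n _ [x [Anx Cx] <-]]].
  by exists n => //; exists x => //; rewrite -(fT Anx).
by exists x; [split=> //; exists n|exact: fT].
Qed.

Lemma glued_image_measurable C : measurable C -> measurable (f @` (D `&` C)).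
Proof.
move=> mC; rewrite glued_image_bigcup; apply: bigcup_measurable => n _.
by apply: (iso_image (isoT n)) => //; exact: measurableI.
Qed.

(** As the sets [A n] increase, so do the images of their traces, and the
    measure of the whole image is the limit of those of [T n @` (A n `&` C)]. *)
Lemma glued_image_mu C : measurable C -> mu (f @` (D `&` C)) = mu (D `&` C).
Proof.
move=> mC; have mAC n : measurable (A n `&` C) by exact: measurableI.
have cvgC : mu (A n `&` C) @[n --> \oo] --> mu (D `&` C).
  rewrite /D setI_bigcupl; apply: nondecreasing_cvg_mu => //.
    exact: bigcup_measurable.
  by move=> m n mn; apply/subsetPset; apply: setSI; exact: ndA.
have cvgfC : mu (T n @` (A n `&` C)) @[n --> \oo] --> mu (f @` (D `&` C)).
  rewrite glued_image_bigcup; apply: nondecreasing_cvg_mu => //.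
  - by move=> n; exact: (iso_image (isoT n)).
  - by rewrite -glued_image_bigcup; exact: glued_image_measurable.
  - move=> m n mn; apply/subsetPset => _ [x [Amx Cx] <-].
    exists x; first by split=> //; exact: ndA Amx.
    by rewrite -(fT Amx) -(fT (ndA mn Amx)).
have eqT : (fun n => mu (T n @` (A n `&` C))) = (fun n => mu (A n `&` C)).
  by apply/funext => n; exact: (iso_mu (isoT n)).
rewrite eqT in cvgfC.
by rewrite -(cvg_lim _ cvgfC)// -(cvg_lim _ cvgC).
Qed.

Lemma glued_preimage_measurable C :
  measurable C -> measurable (D `&` f @^-1` C).
Proof.
move=> mC; have -> : D `&` f @^-1` C = \bigcup_n (A n `&` T n @^-1` C).
  apply/seteqP; split=> [x [[n _ Anx] Cfx]|x [n _ [Anx CTx]]].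
    by exists n => //; split=> //=; rewrite -(fT Anx).
  by split; [exists n|rewrite /= (fT Anx)].
apply: bigcup_measurable => n _.
apply: measurableI => //; rewrite -[X in measurable X]setTI.
exact: (iso_measurable (isoT n)).
Qed.

(** Two points of [D] lie in a common [A n], because the [A n] increase. *)
Lemma glued_inj : {in D &, injective f}.
Proof.
move=> x y /set_mem[m _ Amx] /set_mem[n _ Any].
have Ax : A (maxn m n) x by apply: ndA Amx; exact: leq_maxl.
have Ay : A (maxn m n) y by apply: ndA Any; exact: leq_maxr.
rewrite (fT Ax) (fT Ay); have [_ inj _] := iso_bij (isoT (maxn m n)).
by apply: inj; exact: in_setT.
Qed.

Let mB : measurable B.
Proof. by rewrite /B -[D]setIT; exact: glued_image_measurable. Qed.

(** The domain [D] and the range [B] have the same finite measure. *)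
Lemma glued_range_conull : mu (~` B) = 0.
Proof.
have muD : mu setT = mu D.
  rewrite -(setUv D) measureU ?setICr//; last exact: measurableC.
  by rewrite [X in _ + X]A_conull adde0.
have muB : mu B = mu D by rewrite /B -[D]setIT glued_image_mu.
have muBC : mu B + mu (~` B) = mu B.
  by rewrite -measureU ?setUv ?setICr// ?muB//; exact: measurableC.
have finB : mu B \is a fin_num by rewrite muB -muD ge0_fin_numE.
by rewrite -[mu (~` B)](addeK _ finB) [mu (~` B) + _]addeC muBC subee.
Qed.

(** The union of the [defect n] is the saturation, under [f] and its inverse,
    of the null set where [f] is not known to be defined or onto. *)
Fixpoint defect n : set X :=
  if n is n'.+1 then
    defect n' `|` (D `&` f @^-1` defect n') `|` f @` (D `&` defect n')
  else ~` D `|` ~` B.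

Lemma defect_null n : measurable (defect n) /\ mu (defect n) = 0.
Proof.
elim: n => [|n [mN N0]] /=.
  have mD' := measurableC mD; have mB' := measurableC mB.
  split; first exact: measurableU.
  by rewrite null_set_setU//; exact: glued_range_conull.
have mP := glued_preimage_measurable mN; have mI := glued_image_measurable mN.
have P0 : mu (D `&` f @^-1` defect n) = 0.
  have -> : D `&` f @^-1` defect n = D `&` (D `&` f @^-1` defect n).
    by rewrite setIA setIid.
  rewrite -glued_image_mu//; apply/eqP; rewrite -measure_le0 -N0.
  apply: le_measure; rewrite ?inE//; first exact: glued_image_measurable.
  by move=> _ [x [_ [_ fx]] <-].
have I0 : mu (f @` (D `&` defect n)) = 0.
  rewrite glued_image_mu//; apply/eqP; rewrite -measure_le0 -N0.
  by apply: le_measure; rewrite ?inE//; exact: measurableI.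
split; first by apply: measurableU => //; exact: measurableU.
by rewrite null_set_setU ?null_set_setU//; exact: measurableU.
Qed.

Let E : set X := ~` \bigcup_n defect n.

Let ED : E `<=` D.
Proof.
by move=> x Ex; apply: contrapT => Dx; apply: Ex; exists 0%N => //; left.
Qed.

Let Ef x : D x -> E (f x) <-> E x.
Proof.
move=> Dx; split=> + [n _ Nx]; apply; exists n.+1 => //=.
  by right; exists x.
by left; right.
Qed.

Let E_range y : E y -> exists2 x, E x & f x = y.
Proof.
move=> Ey; have [x Dx fxy] : B y.
  by apply: contrapT => By; apply: Ey; exists 0%N => //; right.
by exists x => //; apply/Ef; rewrite ?fxy.
Qed.

Let mE : measurable E.
Proof.
by apply/measurableC/bigcup_measurable => n _; case: (defect_null n).
Qed.

Let E_conull : mu (~` E) = 0.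
Proof.
apply/negligibleP; first exact: measurableC.
rewrite /E setCK; apply: negligible_bigcup => n.
by have [mN N0] := defect_null n; apply/negligibleP.
Qed.

(** The null sets [~` D] and [~` B] need not have the same cardinality, so the
    bijection from [D] to [B] may have no bijective extension.  Instead, [f]
    permutes the conull set [E], and is replaced by the identity off [E]. *)
Lemma exists_glued_mpbij : exists S : mpbij mu, S = f %[ae mu].
Proof.
pose S x := if `[< E x >] then f x else x.
have SE x : E x -> S x = f x by move=> Ex; rewrite /S asboolT.
have SN x : ~ E x -> S x = x by move=> Ex; rewrite /S asboolF.
have ES x : E (S x) <-> E x.
  have [Ex|Ex] := pselect (E x); last by rewrite SN.
  by rewrite SE//; apply/Ef/ED.
have Simg C : S @` C = f @` (D `&` (E `&` C)) `|` (C `\` E).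
  apply/seteqP; split=> [_ [x Cx <-]|y [[x [_ [Ex Cx]] <-]|[Cy Ey]]].
  - have [Ex|Ex] := pselect (E x); last by right; rewrite SN.
    by left; exists x; [do !split=> //; exact: ED|rewrite SE].
  - by exists x => //; rewrite SE.
  - by exists y => //; rewrite SN.
have isoS : measure_iso mu setT setT S.
  split=> //.
  - split=> //.
      move=> x y _ _ Sxy.
      have [Ex|Ex] := pselect (E x); have Ey := ES y.
        have {}Ey : E y by apply/Ey; rewrite -Sxy; exact/ES.
        by move: Sxy; rewrite !SE//; apply: glued_inj; apply/mem_set/ED.
      have {}Ey : ~ E y by move=> /Ey; rewrite -Sxy => /ES.
      by move: Sxy; rewrite !SN.
    move=> y _; have [Ey|Ey] := pselect (E y).
      by have [x Ex <-] := E_range Ey; exists x => //; exact: SE.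
    by exists y => //; exact: SN.
  - move=> _ C mC; rewrite setTI.
    have -> : S @^-1` C = (E `&` (D `&` f @^-1` C)) `|` (C `\` E).
      apply/seteqP; split=> x /=.
        have [Ex|Ex] := pselect (E x); last by rewrite SN//; right.
        by rewrite SE// => Cfx; left; do !split=> //; exact: ED.
      by case=> [[Ex [Dx Cfx]]|[Cx Ex]]; [rewrite SE|rewrite SN].
    apply: measurableU; last exact: measurableD.
    by apply: measurableI => //; exact: glued_preimage_measurable.
  - move=> C mC _; rewrite Simg; apply: measurableU; last exact: measurableD.
    by apply: glued_image_measurable; exact: measurableI.
  - move=> C mC _; have mEC : measurable (E `&` C) by exact: measurableI.
    have mN : measurable (C `\` E) by exact: measurableD.
    have mfEC := glued_image_measurable mEC.
    have dis : [disjoint f @` (D `&` (E `&` C)) & C `\` E].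
      apply/disj_setPS => y [[x [_ [Ex _]] <-] [_]]; apply.
      exact/Ef/Ex/ED.
    have -> : mu (S @` C) = mu (f @` (D `&` (E `&` C))) + mu (C `\` E).
      by rewrite Simg measureU//; exact/disj_set2P.
    rewrite glued_image_mu// (setIidr (A := D)); last first.
      by move=> x [/ED].
    by rewrite [RHS](measureDI mu mC mE) addeC (setIC E).
exists (Mpbij isoS); exists (~` E); split=> //; first exact: measurableC.
move=> x /= nx Ex; apply: nx => _; exact: SE.
Qed.

End gluing.

(** * Measurability and the integrated distance *)

Section measurability.
Context (R : realType) d (X : measurableType d).
Context (mu : standard_probability X R) (Phi : graphing mu).
Local Notation dist := (graphing_dist Phi).

Lemma measurable_dist (f g : X -> X) :
  measurable_fun setT f -> measurable_fun setT g ->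
  measurable_fun setT (fun x => dist (f x) (g x)).
Proof. exact/graphing_dist_measurable/sp_standard. Qed.

Lemma measurable_eq_set (f g : X -> X) :
  measurable_fun setT f -> measurable_fun setT g ->
  measurable [set x | f x = g x].
Proof.
move=> mf mg; rewrite -[X in measurable X]setTI.
by apply: (@standard_borel_eq R) => //; exact: sp_standard.
Qed.

Lemma measurable_L1 (T : L1_full_group Phi) : measurable_fun setT T.
Proof. exact: iso_measurable (mpbijP (repr (T : Aut mu))). Qed.

Lemma integral_dist_triangle (g f h : X -> X) :
  measurable_fun setT g -> measurable_fun setT f -> measurable_fun setT h ->
  \int[mu]_x dist (f x) (h x) <=
  \int[mu]_x dist (f x) (g x) + \int[mu]_x dist (g x) (h x).
Proof.
have d0 (p q : X -> X) x : setT x -> 0 <= dist (p x) (q x).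
  by move=> _; exact: graphing_dist_ge0.
move=> mg mf mh; rewrite -ge0_integralD//; try exact: measurable_dist;
  try exact: d0.
apply: ge0_le_integral => //; try exact: measurable_dist; try exact: d0.
  by apply: emeasurable_funD; exact: measurable_dist.
by move=> x _; exact: graphing_dist_triangle.
Qed.

End measurability.

(** * Completeness *)

Section completeness.
Context (R : realType) d (X : measurableType d).
Context (mu : standard_probability X R) (Phi : graphing mu).
Local Notation dist := (graphing_dist Phi).

(** The graph distance of distinct points is at least 1, so a summable series
    of distances has only finitely many nonzero terms. *)
Lemma summable_eventually_constant (u : nat -> X) :
  \sum_(0 <= n <oo) dist (u n) (u n.+1) < +oo ->
  exists N, forall n, u (N + n)%N = u N.
Proof.
pose a n := dist (u n) (u n.+1).
have a0 n : 0 <= a n by exact: graphing_dist_ge0.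
move=> /nneseries_tail_cvg/= => /(_ (fun n _ => a0 n)) cv.
have /cv[N _ /(_ N (leqnn N)) /= aN] : nbhs (0 : \bar R) [set y | y < 1].
  by apply: open_nbhs_nbhs; split; [exact: open_ereal_lt_ereal|exact: lte01].
exists N.
elim=> [|n IHn]; first by rewrite addn0.
rewrite addnS -IHn; apply/esym.
have : a (N + n)%N < 1.
  apply: le_lt_trans aN.
  apply: le_trans (nneseries_lim_ge (N + n).+1 (fun k _ _ => a0 k)).
  by rewrite big_nat_recr ?leq_addr//= leeDr// sume_ge0.
by move=> /graphing_dist_lt[[|k] //= _]; rewrite lte_fin ltrn1.
Qed.

Lemma dist_le_series (u : nat -> X) N k :
  dist (u N) (u (N + k)%N) <=
  \sum_(0 <= n <oo) dist (u (N + n)%N) (u (N + n).+1).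
Proof.
apply: le_trans (nneseries_lim_ge k _); last first.
  by move=> *; exact: graphing_dist_ge0.
elim: k => [|k IHk]; first by rewrite addn0 graphing_distxx big_geq.
rewrite big_nat_recr//= addnS.
exact: le_trans (graphing_dist_triangle _ _ _ _) (leeD IHk (lexx _)).
Qed.

(** The bound on the distances is geometric so that the tail of the series from
    [N] on is again at most [2 ^- N]. *)
Lemma fast_Cauchy_cvg (T : nat -> L1_full_group Phi) :
  (forall n, L1_dist (T n) (T n.+1) <= (1 / (2 ^ n.+1)%:R)%:E) ->
  exists S : L1_full_group Phi,
    forall N, L1_dist (T N) S <= (1 / (2 ^ N)%:R)%:E.
Proof.
move=> dT.
pose g N x := \sum_(0 <= n <oo) dist (T (N + n)%N x) (T (N + n).+1 x).
have mT n : measurable_fun setT (T n) := measurable_L1 (T n).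
have g0 N x : 0 <= g N x.
  by apply: nneseries_ge0 => *; exact: graphing_dist_ge0.
have mg N : measurable_fun setT (g N).
  apply: (@ge0_emeasurable_sum _ _ _ _ _ xpredT) => [*|n _].
    exact: graphing_dist_ge0.
  exact: measurable_dist.
have intg N : \int[mu]_x g N x <= (1 / (2 ^ N)%:R)%:E.
  rewrite integral_nneseries//; last by move=> *; exact: graphing_dist_ge0.
    apply: le_trans (epsilon_trick0 xpredT _) => //.
    apply: lee_nneseries => [n _ _|n _].
      by apply: integral_ge0 => x _; exact: graphing_dist_ge0.
    apply: le_trans (dT (N + n)%N) _.
    by rewrite lee_fin -addnS expnD natrM invfM mulrA.
  by move=> n; exact: measurable_dist.
pose A N := [set x | forall n, T (N + n)%N x = T N x].
have mA N : measurable (A N).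
  rewrite (_ : A N = \bigcap_n [set x | T (N + n)%N x = T N x]).
    by apply: bigcapT_measurable => n; exact: (measurable_eq_set mu).
  by apply/seteqP; split=> [x Ax n _|x Ax n]; exact: Ax.
have ndA : {homo A : m n / (m <= n)%N >-> m `<=` n}.
  by move=> m n /subnKC <- x Ax k; rewrite -addnA !Ax.
have A_ae : {ae mu, forall x, exists N, A N x}.
  have : mu.-integrable setT (g 0%N).
    apply/integrableP; split=> //; apply: le_lt_trans (ltry _).
    under eq_integral do rewrite gee0_abs//.
    exact: intg.
  move=> /(integrable_ae measurableT); apply: filterS => x /(_ I).
  rewrite ge0_fin_numE// => /summable_eventually_constant[N TN].
  by exists N.
(* The eventual value of the sequence [T n x]; the identity is a default value
   on the null set where there is none. *)
pose f x := if pselect (exists N, A N x) is left h then T (projT1 (cid h)) x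
            else x.
have fT n x : A n x -> f x = T n x.
  move=> Ax; rewrite /f; case: pselect => [h|]; last by case; exists n.
  case: (cid h) => m /= Am; have [mn|/ltnW nm] := leqP m n.
    by rewrite -(subnKC mn) Am.
  by rewrite -(subnKC nm) Ax.
have [S0 S0f] : exists S : mpbij mu, S = f %[ae mu].
  apply: (exists_glued_mpbij _ (fun n => mpbijP (repr (T n : Aut mu))) mA ndA fT).
    by apply: le_lt_trans (probability_le1 _ measurableT) (ltry _).
  apply/negligibleP; first by apply/measurableC/bigcup_measurable.
  by apply: negligibleS A_ae => x /= nx [N Ax]; apply: nx; exists N.
pose S : Aut mu := (\pi S0)%qT.
have Sf : S = f %[ae mu].
  have /asboolP : mpbij_ae_eq S0 (repr S) by apply/eqmodP; rewrite reprK.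
  by apply: filterS2 S0f => x fx Sx _; rewrite -fx//; exact/esym/Sx.
have mS : measurable_fun setT S := iso_measurable (mpbijP (repr S)).
have dS N : \int[mu]_x dist (T N x) (S x) <= (1 / (2 ^ N)%:R)%:E.
  apply: le_trans (intg N); apply: ae_ge0_le_integral => //.
  - by move=> *; exact: graphing_dist_ge0.
  - exact: measurable_dist.
  - apply: filterS2 Sf A_ae => x Sx [M Ax] _; rewrite Sx//.
    rewrite (fT (N + M)%N); first exact: (dist_le_series (fun n => T n x)).
    by apply: ndA Ax; exact: leq_addl.
have S1 : S \in L1_full_set Phi.
  apply/mem_set; split.
    have : {ae mu, forall x, forall n, graphing_rel Phi (x, T n x)}.
      by apply: ae_foralln => n; have /set_mem[] := valP (T n).
    by apply: filterS3 Sf A_ae => x Sx [M Ax] Tx; rewrite Sx// (fT M).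
  (* The limit is at finite distance from the identity because it is at finite
     distance from [T 0]. *)
  have mid : measurable_fun setT (@id X) by exact: measurable_id.
  apply: le_lt_trans (integral_dist_triangle Phi (mT 0%N) mid mS) _.
  have /set_mem[_ T1] := valP (T 0%N).
  by rewrite lte_add_pinfty//; apply: le_lt_trans (dS _) (ltry _).
by exists (exist _ S S1).
Qed.

Lemma L1_full_group_complete : complete_space (L1_full_group Phi).
Proof.
move=> F FF /cauchyP Fc.
pose r n : R := (1 / (2 ^ n)%:R)%R.
have r0 n : (0 < r n)%R by rewrite divr_gt0 ?ltr0n ?expn_gt0.
have rS n : (r n = r n.+1 + r n.+1)%R.
  by rewrite /r expnS natrM invfM; lra.
(* Balls in a proper filter meet, so the centers of balls of radius [r n.+2]
   are at distance at most [r n.+2 + r n.+3 <= r n.+1]. *)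
have /choice[T FT] (n : nat) :
    exists T : L1_full_group Phi, F (ball T (r n.+2)).
  exact: Fc.
have dT n : L1_dist (T n) (T n.+1) <= (r n.+1)%:E.
  have [U []] := filter_ex (filterI (FT n) (FT n.+1)).
  rewrite !ballEmdist/= -L1_mdistE lee_fin => nU SU.
  apply: le_trans (metric_triangle _ U _) _; rewrite [X in (_ + X)%R]metric_sym.
  by have := rS n.+1; have := rS n.+2; have := r0 n.+3; lra.
have [S dS] := fast_Cauchy_cvg dT.
exists S; apply/fcvg_ballP => e e0.
have [N _ /(_ N (leqnn N)) /= Ne] := near_infty_natSinv_expn_lt (PosNum e0).
rewrite -natrX -/(r N) in Ne.
apply: filterS (FT N.+1) => U; rewrite !ballEmdist/= => TU.
apply: le_lt_trans (metric_triangle _ (T N.+1) _) _.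
have ST : (mdist S (T N.+1) <= r N.+1)%R.
  by rewrite metric_sym -lee_fin L1_mdistE dS.
by have := rS N; have := rS N.+1; have := rS N.+2; have := r0 N.+3; lra.
Qed.

End completeness.

(** * Separability of the measure algebra *)

Lemma measurable_setY d (X : measurableType d) (A B : set X) :
  measurable A -> measurable B -> measurable (A `+` B).
Proof. by move=> mA mB; apply: measurableU; exact: measurableD. Qed.

Section approximation.
Context (R : realType) d (X : measurableType d).
Context (mu : {measure set X -> \bar R}).
Context (mu_fin : mu setT < +oo) (G : set (set X)).
Context (mG : G `<=` measurable).
Context (G0 : G set0).
Context (GC : forall A, G A -> G (~` A)).
Context (GU : forall A B, G A -> G B -> G (A `|` B)).

Let approximable : set (set X) := [set A | measurable A /\
  forall e : R, (0 < e)%R -> exists2 B, G B & mu (A `+` B) < e%:E].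

Let approximableU A B :
  approximable A -> approximable B -> approximable (A `|` B).
Proof.
move=> [mA gA] [mB gB]; split=> [|e e0]; first exact: measurableU.
have [|C GC' AC] := gA (e / 2)%R; first by rewrite divr_gt0.
have [|D GD BD] := gB (e / 2)%R; first by rewrite divr_gt0.
exists (C `|` D); first exact: GU.
have mC := mG GC'; have mD := mG GD.
have mAC : measurable (A `+` C) by exact: measurable_setY.
have mBD : measurable (B `+` D) by exact: measurable_setY.
apply: (@le_lt_trans _ _ (mu ((A `+` C) `|` (B `+` D)))).
  apply: le_measure; rewrite ?inE; last 2 first.
  - exact: measurableU.
  - by move=> x; rewrite /setY /=; tauto.
  by apply: measurable_setY; exact: measurableU.
apply: le_lt_trans (measureU2 _ _ _) _ => //.
by rewrite (splitr e) EFinD lteD.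
Qed.

Let sub_approximable : <<s G>> `<=` approximable.
Proof.
apply: smallest_sub; last first.
  move=> A GA; split=> [|e e0]; first exact: mG.
  by exists A => //; rewrite setYK measure0 lte_fin.
split.
- by split=> // e e0; exists set0; rewrite // setYK measure0 lte_fin.
- move=> A [mA gA]; split=> [|e e0]; first exact: measurableD.
  have [B GB AB] := gA e e0; exists (~` B); first exact: GC.
  by rewrite (_ : _ `+` _ = A `+` B)//; apply/seteqP; split=> x; rewrite /setY /=;
    have [] := pselect (A x); have [] := pselect (B x); tauto.
- move=> F aF.
  have mF n : measurable (F n) by case: (aF n).
  pose A := \bigcup_n F n; pose H n := \big[setU/set0]_(i < n) F i.
  have a0 : approximable set0.
    by split=> // e e0; exists set0; rewrite // setYK measure0 lte_fin.
  have aH n : approximable (H n).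
    by rewrite /H; elim/big_ind : _ => // B C; exact: approximableU.
  have mA : measurable A by exact: bigcup_measurable.
  have mH n : measurable (H n) by case: (aH n).
  have mAH n : measurable (A `\` H n) by exact: measurableD.
  split=> // e e0.
  have AH0 : \bigcap_n (A `\` H n) = set0.
    rewrite -subset0 => x AHx; have [[n _ Fx] _] := AHx 0%N I.
    have [_] := AHx n.+1 I; apply.
    by rewrite /H -bigcup_mkord; exists n => /=.
  have : mu (A `\` H n) @[n --> \oo] --> mu (\bigcap_n (A `\` H n)).
    apply: nonincreasing_cvg_mu => //; last 2 first.
    - by rewrite AH0.
    - move=> m n mn; apply/subsetPset => x [Ax Hx]; split=> //; apply: contra_not Hx.
      rewrite /H -!bigcup_mkord => -[i im Fx]; exists i => //=.
      exact: leq_trans im mn.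
    by apply: le_lt_trans mu_fin; apply: le_measure; rewrite ?inE.
  rewrite AH0 measure0 => /(_ [set y | y < (e / 2)%:E]) [].
    apply: open_nbhs_nbhs; split; first exact: open_ereal_lt_ereal.
    by rewrite /= lte_fin divr_gt0.
  move=> n _ /(_ n (leqnn n)) /= An.
  have [|B GB HB] := (aH n).2 (e / 2)%R; first by rewrite divr_gt0.
  exists B => //; have mB := mG GB.
  have mHB : measurable (H n `+` B) by exact: measurable_setY.
  apply: (@le_lt_trans _ _ (mu ((A `\` H n) `|` (H n `+` B)))).
    apply: le_measure; rewrite ?inE; [exact: measurable_setY|exact: measurableU|].
    have HA : H n `<=` A.
      by rewrite /H -bigcup_mkord => y [i _ Fy]; exists i.
    move=> x; have := HA x; rewrite /setY /=.
    by have [] := pselect (H n x); tauto.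
  apply: le_lt_trans (measureU2 _ _ _) _ => //.
  by rewrite (splitr e) EFinD lteD.
Qed.

(** An algebra of sets is dense, for a finite measure, in the sigma-algebra
    which it generates: the sets that it approximates form a sigma-algebra, as
    a countable union is approximated by its finite subunions. *)
Lemma sigma_algebra_approx A (e : R) : <<s G>> A -> (0 < e)%R ->
  exists2 B, G B & mu (A `+` B) < e%:E.
Proof. by move=> /sub_approximable[_]; exact. Qed.

End approximation.

Section standard_borel.
Context (R : realType) d (X : measurableType d).

(** In a separable metric space, every open set is the union of the balls which
    it contains among those with center in a countable dense set and radius
    [n.+1%:R^-1]; this union is countable. *)
Lemma standard_borel_countably_generated : standard_borel R X ->
  exists U : nat * nat -> set X, forall A, measurable A <-> <<s range U>> A.
Proof.
move=> [Y [h [_ [Q Qct Qdense] [h' hK h'K] hB]]].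
have oball (q : Y) (e : R) : open (ball q e).
  rewrite openE => y; rewrite ballEmdist/= -subr_gt0 => qy.
  apply/nbhs_ballP; exists (e - mdist q y)%R => //= z.
  rewrite !ballEmdist/= ltrBrDl; exact: le_lt_trans (metric_triangle _ _ _).
have [e Qe] : exists e : nat -> Y, Q `<=` range e.
  move: Qct => /pfcard_geP[Q0|[e]].
    by exists (fun=> h point) => y; rewrite Q0.
  by exists e => y Qy; have [n _ en] := 'surj_e Qy; exists n.
pose V (i : nat * nat) : set Y := ball (e i.1) i.2.+1%:R^-1.
exists (fun i => h @^-1` V i) => A; split=> [mA|]; last first.
  apply: smallest_sub; first exact: sigma_algebra_measurable.
  move=> _ [i _ <-]; apply: (proj1 (hB _)); apply: sub_sigma_algebra; exact: oball.
pose G := range (fun i => h @^-1` V i); rewrite -/G.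
have <- : h @^-1` (h' @^-1` A) = A.
  by apply/seteqP; split=> x /=; rewrite hK.
have : <<s open >> (h' @^-1` A).
  apply/hB; rewrite (_ : _ @^-1` _ = A)//.
  by apply/seteqP; split=> x /=; rewrite hK.
have [G0 GC GU] := @smallest_sigma_algebra X setT G.
suff : <<s open>> `<=` [set B : set Y | <<s G>> (h @^-1` B)] by apply.
apply: smallest_sub.
  split=> [|B GB|F GF].
  - by rewrite /= preimage_set0.
  - exact: GC.
  - by rewrite /= preimage_bigcup; exact: GU.
move=> O oO /=.
have -> : h @^-1` O = \bigcup_m \bigcup_n
    (if `[< V (m, n) `<=` O >] then h @^-1` V (m, n) else set0).
  apply/seteqP; split=> [x Ox|x [m _ [n _]]]; last first.
    by case: asboolP => // VO; exact: VO.
  have /nbhs_ballP[r /= r0 rO] : nbhs (h x) O by exact: open_nbhs_nbhs.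
  have /ltr_add_invr[n] : (0 < r / 2)%R by rewrite divr_gt0.
  rewrite add0r => nr.
  have [||q [hq /Qe[m _ mq]]] := Qdense (ball (h x) n.+1%:R^-1) => //.
    by exists (h x); apply: ballxx; rewrite invr_gt0.
  exists m => //; exists n => //; rewrite asboolT.
    by rewrite /V /= mq; exact: ball_sym.
  move=> y; rewrite /V/= mq => qy; apply: rO.
  apply: (le_ball _ (ball_triangle hq qy)).
  by rewrite [leRHS]splitr lerD// ltW.
apply: (GU) => m; apply: (GU) => n; case: asboolP => // _.
by apply: sub_sigma_algebra; exists (m, n).
Qed.

End standard_borel.

Section generated_algebra.
Context (X : Type) (I : Type) (U : I -> set X).

(** A tree denotes an iterated complement of finite unions of the [U i].  This
    single operation generates all Boolean combinations, and its terms are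
    elements of a countable type. *)
Fixpoint nor_eval (t : GenTree.tree I) : set X :=
  match t with
  | GenTree.Leaf i => U i
  | GenTree.Node _ ts => ~` foldr (fun t A => nor_eval t `|` A) set0 ts
  end.

Lemma nor_eval0 : range nor_eval set0.
Proof.
exists (GenTree.Node 0 [:: GenTree.Node 0 [::]]) => //=.
by rewrite setC0 setU0 setCT.
Qed.

Lemma nor_evalC A : range nor_eval A -> range nor_eval (~` A).
Proof. by move=> [t _ <-]; exists (GenTree.Node 0 [:: t]); rewrite //= setU0. Qed.

Lemma nor_evalU A B : range nor_eval A -> range nor_eval B ->
  range nor_eval (A `|` B).
Proof.
move=> [s _ <-] [t _ <-]; rewrite -[_ `|` _]setCK; apply: nor_evalC.
by exists (GenTree.Node 0 [:: s; t]); rewrite //= setU0.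
Qed.

End generated_algebra.

Lemma nor_eval_measurable d (X : measurableType d) I (U : I -> set X) :
  (forall i, measurable (U i)) -> forall t, measurable (nor_eval U t).
Proof.
move=> mU; fix IH 1 => -[i|n ts] /=; first exact: mU.
apply: measurableC; elim: ts => [|t ts IHts] /=; first exact: measurable0.
by apply: measurableU => //; exact: IH.
Qed.

Lemma countable_approximating_family (R : realType) d (X : measurableType d)
    (mu : {measure set X -> \bar R}) : mu setT < +oo -> standard_borel R X ->
  exists (I : countType) (B : I -> set X), (forall i, measurable (B i)) /\
    forall A (e : R), measurable A -> (0 < e)%R ->
      exists i, mu (A `+` B i) < e%:E.
Proof.
move=> mu_fin /standard_borel_countably_generated[U UP].
have mU i : measurable (U i) by apply/UP; apply: sub_sigma_algebra; exists i.
exists (GenTree.tree (nat * nat)%type), (nor_eval U); split.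
  exact: nor_eval_measurable.
move=> A e /UP UA e0.
have mG : range (nor_eval U) `<=` measurable.
  by move=> _ [t _ <-]; exact: nor_eval_measurable.
have GA : <<s range (nor_eval U) >> A.
  move: UA; apply: sub_smallest2r; first exact: smallest_sigma_algebra.
  by move=> _ [i _ <-]; exists (GenTree.Leaf i).
have [_ [i _ <-]] := sigma_algebra_approx mu_fin mG (nor_eval0 U)
  (@nor_evalC _ _ U) (@nor_evalU _ _ U) GA e0.
by exists i.
Qed.

(** * Words in a graphing *)

Section words.
Context (R : realType) d (X : measurableType d).
Context (mu : {measure set X -> \bar R}) (Phi : graphing mu).
Local Notation dist := (graphing_dist Phi).

Lemma measurable_fun_patch (D : set X) (f g : X -> X) :
  measurable D -> measurable_fun D f -> measurable_fun setT g ->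
  measurable_fun setT (fun x => if `[< D x >] then f x else g x).
Proof.
move=> mD mf mg _ C mC; rewrite setTI.
rewrite (_ : _ @^-1` _ = (D `&` f @^-1` C) `|` (g @^-1` C `\` D)).
  apply: measurableU; first exact: mf.
  by apply: measurableD => //; rewrite -[X in measurable X]setTI; exact: mg.
apply/seteqP; split=> x /=; case: asboolP => Dx; [by left|by right| |].
  by case=> -[].
by case=> -[].
Qed.

(** Each element of the graphing and each inverse is extended by the identity,
    which makes it a total map and still moves points by at most one step.
    The Boolean tells an element from its inverse. *)
Lemma exists_letters : exists l : nat * bool -> X -> X,
  [/\ forall k, measurable_fun setT (l k),
      forall k x, dist x (l k x) <= 1 &
      forall x y, graphing_step Phi x y -> exists k, y = l k x].
Proof.
have := gset_countable Phi => /pfcard_geP[Phi0|[e]].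
  exists (fun=> id); split=> // [k x|x y [phi]]; last by rewrite Phi0.
  by rewrite graphing_distxx lee01.
pose inv (phi : partial_iso mu) := 'pinv_(fun=> point) (pdom phi) phi.
pose l (k : nat * bool) (x : X) := if k.2
  then (if `[< pdom (e k.1) x >] then e k.1 x else x)
  else (if `[< prng (e k.1) x >] then inv (e k.1) x else x).
have ePhi n : gset Phi (e n) by exact: funS.
exists l; split.
- move=> [n []]; apply: measurable_fun_patch; rewrite //=.
  + exact: iso_dom (pfunP _).
  + exact: iso_measurable (pfunP _).
  + exact: iso_rng (pfunP _).
  + exact: measure_iso_pinv (pfunP _).
- have d1 x : dist x x <= 1 by rewrite graphing_distxx lee01.
  move=> [n []] x; rewrite /l /=; case: asboolP => // Dx;
    apply: (graphing_dist_le (n := 1)); exists x => //; exists (e n) => //.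
    by left.
  right; have [_ _ surj] := iso_bij (pfunP (e n)).
  have [z Dz <-] := surj _ Dx.
  have [_ inj _] := iso_bij (pfunP (e n)).
  by rewrite /inv pinvKV ?inE.
- move=> x y [phi Pphi step]; have [n _ en] := 'surj_e Pphi.
  case: step => [[Dx ->]|[Dy ->]].
    by exists (n, true); rewrite /l /= en asboolT.
  have [img inj _] := iso_bij (pfunP phi).
  exists (n, false); rewrite /l /= en asboolT; last exact: img.
  by rewrite /inv pinvKV ?inE.
Qed.

(** The words are the compositions of letters; the length of a word bounds the
    distance by which it moves points. *)
Lemma exists_words : exists (J : countType) (w : J -> X -> X),
  [/\ forall j, measurable_fun setT (w j),
      forall j, exists K : nat, forall x, dist x (w j x) <= K%:R%:E &
      forall n x y, graphing_walk Phi n x y -> exists j, y = w j x].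
Proof.
have [l [ml l1 lstep]] := exists_letters.
pose w (s : seq (nat * bool)) (x : X) := foldr l x s.
exists (seq (nat * bool)), w; split.
- elim=> [|k s IHs]; first exact: measurable_id.
  exact: measurableT_comp (ml k) IHs.
- elim=> [|k s [K IHs]]; first by exists 0%N => x; rewrite graphing_distxx.
  exists K.+1 => x; rewrite -addn1 natrD EFinD.
  apply: le_trans (graphing_dist_triangle _ (w s x) _ _) _.
  exact: leeD (IHs x) (l1 k _).
- elim=> [|n IHn] x y /=; first by move=> <-; exists [::].
  by move=> [z /IHn[s ->] /lstep[k ->]]; exists (k :: s).
Qed.

End words.

(** * Piecewise maps *)

(** The first piece which contains the point decides, so that overlapping pieces
    still define a map; hence the pieces may be replaced by approximations.
    Points outside all pieces are fixed, which keeps the map bounded. *)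
Definition piecewise (X K : Type) (A : K -> set X) (v : K -> X -> X)
    (s : seq K) : X -> X :=
  foldr (fun k g x => if `[< A k x >] then v k x else g x) id s.

Lemma piecewise_measurable d (X : measurableType d) (K : Type)
    (A : K -> set X) (v : K -> X -> X) (s : seq K) :
  (forall k, measurable (A k)) -> (forall k, measurable_fun setT (v k)) ->
  measurable_fun setT (piecewise A v s).
Proof.
move=> mA mv; elim: s => [|k s IHs]; first exact: measurable_id.
apply: measurable_fun_patch => //.
exact: measurable_funS (mv k).
Qed.

Lemma piecewise_bounded (R : realType) d (X : measurableType d)
    (mu : {measure set X -> \bar R}) (Phi : graphing mu) (K : Type)
    (A : K -> set X) (v : K -> X -> X) (s : seq K) :
  (forall k, exists N : nat, forall x, graphing_dist Phi x (v k x) <= N%:R%:E) ->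
  exists N : nat, forall x, graphing_dist Phi x (piecewise A v s x) <= N%:R%:E.
Proof.
move=> bv; elim: s => [|k s [N IHs]].
  by exists 0%N => x; rewrite graphing_distxx.
have [M bM] := bv k; exists (maxn M N) => x /=; case: asboolP => _.
  by apply: le_trans (bM x) _; rewrite lee_fin ler_nat leq_maxl.
by apply: le_trans (IHs x) _; rewrite lee_fin ler_nat leq_maxr.
Qed.

(** When every piece carries a map which agrees there with a given [t], overlaps
    of the pieces are harmless. *)
Lemma piecewise_selection (X : Type) (K : eqType) (A : K -> set X)
    (v : K -> X -> X) (s : seq K) (t : X -> X) (x : X) : (forall k, A k x -> v k x = t x) ->
  piecewise A v s x = t x \/
  piecewise A v s x = x /\ {in s, forall k, ~ A k x}.
Proof.
move=> Av; elim: s => [|k s IHs] /=; first by right.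
case: asboolP => Ax; first by left; exact: Av.
by case: IHs => [->|[-> As]]; [left|right; split=> // j /predU1P[->|/As]].
Qed.

Section piecewise_approximation.
Context (R : realType) d (X : measurableType d).
Context (mu : standard_probability X R) (Phi : graphing mu).
Local Notation dist := (graphing_dist Phi).
Context (I J : Type) (B : I -> set X) (w : J -> X -> X).
Context (mB : forall i, measurable (B i)).
Context (B_approx : forall A (e : R), measurable A -> (0 < e)%R ->
  exists i, mu (A `+` B i) < e%:E).
Context (mw : forall j, measurable_fun setT (w j)).
Context (w_bounded :
  forall j, exists K : nat, forall x, dist x (w j x) <= K%:R%:E).

(** The pieces are replaced one at a time.  Replacing [A j] by [B i] changes the
    map only on their symmetric difference, whose measure may be chosen small
    after the bounds on [w j] and on the approximation [g] of the remaining
    pieces are known. *)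
Lemma piecewise_approx (A : J -> set X) (s : seq J) (e : R) :
  (forall j, measurable (A j)) -> (0 < e)%R ->
  exists c : seq (I * J), \int[mu]_x dist (piecewise A w s x)
    (piecewise (B \o fst) (w \o snd) c x) < e%:E.
Proof.
move=> mA; elim: s e => [|j s IHs] e e0.
  exists [::]; rewrite integral0_eq ?lte_fin// => x _.
  exact: graphing_distxx.
have [|c fc] := IHs (e / 2)%R; first by rewrite divr_gt0.
set f := piecewise A w s in fc; set g := piecewise _ _ c in fc.
have mf : measurable_fun setT f by exact: piecewise_measurable.
have mg : measurable_fun setT g.
  by apply: piecewise_measurable => k; [exact: mB|exact: mw].
have [M wM] := w_bounded j.
have [N gN] : exists N : nat, forall x, dist x (g x) <= N%:R%:E.
  by apply: piecewise_bounded => k; exact: w_bounded.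
(* The successor avoids a division by zero when both bounds vanish. *)
have eK0 : (0 < e / 2 / (M + N).+1%:R :> R)%R by rewrite !divr_gt0.
have [i Bi] := B_approx (mA j) eK0.
pose D := A j `+` B i; have mD : measurable D by exact: measurable_setY.
exists ((i, j) :: c).
set F := piecewise A w _; set G := piecewise _ _ _.
have mF : measurable_fun setT F by exact: piecewise_measurable.
have mG : measurable_fun setT G.
  by apply: piecewise_measurable => k; [exact: mB|exact: mw].
have wg x : dist (w j x) (g x) <= (M + N)%:R%:E.
  rewrite natrD EFinD; apply: le_trans (graphing_dist_triangle _ x _ _) _.
  by rewrite leeD// graphing_dist_sym.
have key x : dist (F x) (G x) <= dist (f x) (g x) + (M + N)%:R%:E * (\1_D x)%:E.
  rewrite /F /G /= -/f -/g indicE.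
  have d0 := graphing_dist_ge0 Phi (f x) (g x).
  have [Ax|Ax] := asboolP (A j x); have [Bx|Bx] := asboolP (B i x).
  - by rewrite graphing_distxx adde_ge0// mule_ge0// lee_fin.
  - rewrite mem_set; last by left.
    by rewrite mule1 (le_trans (wg x))// leeDr.
  - rewrite mem_set; last by right.
    rewrite mule1; apply: le_trans (graphing_dist_triangle _ (g x) _ _) _.
    by rewrite leeD2l// graphing_dist_sym.
  - by rewrite memNset ?mule0 ?adde0// => -[[]|[]].
have mI : measurable_fun setT (fun x => (M + N)%:R%:E * (\1_D x)%:E : \bar R).
  apply: measurable_funeM; apply/measurable_EFinP; exact: measurable_indic.
apply: (@le_lt_trans _ _ (\int[mu]_x (dist (f x) (g x) +
    (M + N)%:R%:E * (\1_D x)%:E))).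
  apply: ge0_le_integral => //.
  - by move=> *; exact: graphing_dist_ge0.
  - exact: measurable_dist.
  - by apply: emeasurable_funD => //; exact: measurable_dist.
rewrite ge0_integralD//; last 2 first.
- by move=> *; exact: graphing_dist_ge0.
- exact: measurable_dist.
rewrite ge0_integralZl//; last first.
  by apply/measurable_EFinP; exact: measurable_indic.
rewrite integral_indic// setIT (splitr e) EFinD lteD//.
apply: (@le_lt_trans _ _ ((M + N).+1%:R%:E * mu D)).
  by rewrite lee_wpmul2r// lee_fin ler_nat.
by rewrite muleC -lte_pdivlMr// -?EFinV.
Qed.

End piecewise_approximation.

(** * Separability *)

Section separability.
Context (R : realType) d (X : measurableType d).
Context (mu : standard_probability X R) (Phi : graphing mu).
Local Notation dist := (graphing_dist Phi).

Lemma L1_integrable_displacement (T : L1_full_group Phi) :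
  mu.-integrable setT (fun x => dist x (T x)).
Proof.
apply/integrableP; split.
  by apply: measurable_dist => //; exact: measurable_L1.
under eq_integral do rewrite gee0_abs ?graphing_dist_ge0//.
by have /set_mem[] := valP T.
Qed.

(** The approximating maps are measurable but, in general, neither injective nor
    measure-preserving: they do not belong to the L1 full group. *)
Lemma countable_step_maps : exists (C : countType) (g : C -> X -> X),
  (forall c, measurable_fun setT (g c)) /\
  forall (T : L1_full_group Phi) (e : R), (0 < e)%R ->
    exists c, \int[mu]_x dist (T x) (g c x) < e%:E.
Proof.
have mu_fin : mu setT < +oo.
  by apply: le_lt_trans (probability_le1 _ measurableT) (ltry _).
have [K [B [mB B_approx]]] :=
  countable_approximating_family mu_fin (sp_standard mu).
have [J [w [mw bw walk_w]]] := exists_words Phi.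
exists (seq (K * J)), (piecewise (B \o fst) (w \o snd)); split=> [c|T e e0].
  by apply: piecewise_measurable => k; [exact: mB|exact: mw].
have mT := measurable_L1 T.
pose A j := [set x | w j x = T x].
have mA j : measurable (A j) by exact: (measurable_eq_set mu).
(* [s n] lists the words with code below [n], so that [f n x] is [T x] as soon
   as one of them maps [x] to [T x], and [x] before that. *)
pose s n := pmap (@unpickle J) (iota 0 n).
pose f n := piecewise A w (s n).
have mf n : measurable_fun setT (f n) by exact: piecewise_measurable.
have fT n x : f n x = T x \/ f n x = x /\ {in s n, forall j, ~ A j x}.
  exact: piecewise_selection.
have cvf : \int[mu]_x dist (T x) (f n x) @[n --> \oo] -->
    \int[mu]_x (cst 0 x : \bar R).
  have [|||||_ _] := @dominated_convergence _ _ _ mu setT measurableT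
    (fun n x => dist (T x) (f n x)) (cst 0) (fun x => dist x (T x)) => //.
  - by move=> n; exact: measurable_dist.
  - apply: filterS (integrable_ae measurableT (L1_integrable_displacement T)).
    move=> x /(_ I) /= + _; rewrite ge0_fin_numE ?graphing_dist_ge0//.
    move=> /graphing_dist_lt[k /walk_w[j wj] _].
    apply: cvg_near_cst; exists (pickle j).+1 => // n /= jn.
    have [->|[_ /(_ j)[]]] := fT n x; rewrite ?graphing_distxx//.
    rewrite mem_pmap; apply/mapP; exists (pickle j); last by rewrite pickleK.
    by rewrite mem_iota.
  - exact: L1_integrable_displacement.
  - apply: aeW => x n _ /=; rewrite gee0_abs ?graphing_dist_ge0//.
    have [->|[-> _]] := fT n x; last by rewrite graphing_dist_sym.
    by rewrite graphing_distxx graphing_dist_ge0.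
have [n fn] : exists n, \int[mu]_x dist (T x) (f n x) < (e / 2)%:E.
  rewrite integral_cst// mul0e in cvf.
  have /cvf[n _ /(_ n (leqnn n)) /= fn] :
      nbhs (0 : \bar R) [set y | y < (e / 2)%:E].
    apply: open_nbhs_nbhs; split; first exact: open_ereal_lt_ereal.
    by rewrite /= lte_fin divr_gt0.
  by exists n.
have [|c fc] := piecewise_approx mB B_approx mw bw (s n) mA (e := (e / 2)%R).
  by rewrite divr_gt0.
exists c; set g := piecewise _ _ c in fc *.
have mg : measurable_fun setT g.
  by apply: piecewise_measurable => k; [exact: mB|exact: mw].
apply: le_lt_trans (integral_dist_triangle Phi (mf n) mT mg) _.
by rewrite (splitr e) EFinD lteD.
Qed.

(** A subset of a separable space is separable: near each step map, at each
    scale, one picks an element of the L1 full group if there is one. *)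
Lemma L1_full_group_separable : separable_space (L1_full_group Phi).
Proof.
have [C [g [mg g_approx]]] := countable_step_maps.
pose near_g (c : C * nat) (T : L1_full_group Phi) :=
  \int[mu]_x dist (T x) (g c.1 x) < (c.2.+1%:R^-1)%:E.
pose sel c : option (L1_full_group Phi) :=
  if pselect (exists T, near_g c T) is left h then Some (projT1 (cid h))
  else None.
have selP c T : near_g c T -> exists2 S, sel c = Some S & near_g c S.
  move=> cT; rewrite /sel; case: pselect => [h|]; last by case; exists T.
  by exists (projT1 (cid h)) => //; case: (cid h).
exists [set T | exists c, sel c = Some T].
  rewrite (_ : mkset _ = \bigcup_c [set T | sel c = Some T]).
    apply: bigcup_countable => [//|c _].
    case: (sel c) => [S|]; last first.
      by rewrite (_ : mkset _ = set0)//; apply/seteqP; split.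
    rewrite (_ : mkset _ = [set S]); first exact: countable1.
    by apply/seteqP; split=> T /= [->].
  by apply/seteqP; split=> T [c]; [exists c|move=> _; exists c].
move=> O [T OT] oO.
have /nbhs_ballP[e /= e0 eO] : nbhs T O by exact: open_nbhs_nbhs.
have /ltr_add_invr[n] : (0 < e / 2)%R by rewrite divr_gt0.
rewrite add0r => ne.
have [|c Tc] := g_approx T n.+1%:R^-1%R; first by rewrite invr_gt0.
have [S Sc near_S] := selP (c, n) T Tc.
exists S; split; last by exists (c, n).
apply: eO; rewrite ballEmdist /= -lte_fin L1_mdistE.
apply: le_lt_trans (integral_dist_triangle Phi (mg c) _ _) _;
  try exact: measurable_L1.
rewrite [X in _ + X](_ : _ = \int[mu]_x dist (S x) (g c x)); last first.
  by apply: eq_integral => x _; rewrite graphing_dist_sym.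
rewrite (splitr e) EFinD lteD//.
  by apply: lt_trans Tc _; rewrite lte_fin.
by apply: lt_trans near_S _; rewrite lte_fin.
Qed.

End separability.

Theorem proposition3p4 (R : realType) (d : measure_display)
    (X : measurableType d) (mu : standard_probability X R)
    (Phi : graphing mu) :
  complete_space (L1_full_group Phi) /\ separable_space (L1_full_group Phi).
Proof.
by split; [exact: L1_full_group_complete|exact: L1_full_group_separable].
Qed.
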